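(* Let $d\ge 4$ be an integer. Let $A\subseteq\mathbb{P}\mathbb{R}[x,y]_d$ be the set of all forms with a maximal gap between their Waring rank and their real Waring rank, i.e. the forms $F$ for which $\operatorname{rk}_{\mathbb{R}}(F)-\operatorname{rk}(F)$ is the largest value attained on $\mathbb{P}\mathbb{R}[x,y]_d$. Then $$A=\bigcup_{\mathscr{L}}\operatorname{Im}(\Gamma_{\mathscr{L}}),$$ where $\mathscr{L}=(L_1,L_2,L_3)$ ranges over all triples of pairwise distinct elements of $\mathbb{P}\mathbb{R}[x,y]_1$.
   Context: For a field $k\in\{\mathbb{R},\mathbb{C}\}$ and a nonzero form $F\in k[x,y]_d$, the rank of $F$ over $k$ is the least $m$ such that $F=a_1L_1^d+\dots+a_mL_m^d$ with $a_i\in k$ and $L_i\in k[x,y]_1$. For $k=\mathbb{C}$ it is the Waring rank $\operatorname{rk}(F)$; for $k=\mathbb{R}$ it is the real Waring rank $\operatorname{rk}_{\mathbb{R}}(F)$. Both are invariant under nonzero scaling. $\mathbb{P}\mathbb{R}[x,y]_i$ denotes the real projective space of forms of degree $i$, regarded as a subset of $\mathbb{P}S_i$, where $S=\mathbb{C}[x,y]$ and $\mathbb{P}S_i$ is the projectivization of the space $S_i$ of complex forms of degree $i$. The group $\mathrm{GL}_2(\mathbb{C})$ acts on $S_1$ (with basis $x,y$) and on $S_d=\mathrm{Sym}^d S_1$ by linear change of coordinates; this induces an action of $\mathrm{PGL}_2(\mathbb{C})$ on $\mathbb{P}S_1$ and $\mathbb{P}S_d$. Let $\Theta\subseteq\mathbb{C}$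 be the set of $d$-th roots of unity and $\Theta^3\setminus\Delta$ the set of triples of pairwise distinct elements of $\Theta$. For a triple $\mathscr{L}=(L_1,L_2,L_3)$ of pairwise distinct elements of $\mathbb{P}S_1$, the map $\Gamma_{\mathscr{L}}\colon\Theta^3\setminus\Delta\to\mathbb{P}S_d$ is defined as follows: for $(\xi_i,\xi_j,\xi_k)\in\Theta^3\setminus\Delta$ there is a unique $\varphi\in\mathrm{PGL}_2(\mathbb{C})$ with $\varphi([x-\xi_iy])=L_1$, $\varphi([x-\xi_jy])=L_2$, $\varphi([x-\xi_ky])=L_3$; set $\Gamma_{\mathscr{L}}(\xi_i,\xi_j,\xi_k)=\varphi\cdot[x^d-y^d]$. *)

(* Defs.v *)
From HB Require Import structures.
From mathcomp Require Import all_boot all_order all_algebra.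
From mathcomp Require Import boolp classical_sets reals.
From mathcomp Require Import complex.
From mathcomp Require Import mpoly.

Set Implicit Arguments.
Unset Strict Implicit.
Unset Printing Implicit Defensive.

Import Order.TTheory GRing.Theory Num.Theory.

Local Open Scope classical_set_scope.
Local Open Scope ring_scope.

Section Forms.
Variable K : fieldType.

(* Binary forms are elements of {mpoly K[2]}, with x = 'X_0 and y = 'X_1. *)
Definition xvar : {mpoly K[2]} := 'X_(ord0).
Definition yvar : {mpoly K[2]} := 'X_(ord_max).

Definition nonzero_forms (d : nat) : set {mpoly K[2]} :=
  [set F | F \is d.-homog /\ F != 0].

(* The zero form is 1.-homog, hence allowed as one of the L_i. *)
Definition power_sum (d : nat) (F : {mpoly K[2]}) (m : nat) : Prop :=
  exists (a : 'I_m -> K) (L : 'I_m -> {mpoly K[2]}),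
    (forall i, L i \is 1.-homog) /\ F = \sum_(i < m) a i *: L i ^+ d.

(* In characteristic 0 every form of degree d is a sum of this kind for some
   m, so over the real and complex numbers the default value 0 of xget is not
   used. *)
Definition form_rank (d : nat) (F : {mpoly K[2]}) : nat :=
  xget 0%N [set m | power_sum d F m /\
                    forall m', power_sum d F m' -> (m <= m')%N].

(* The point [v] of the projectivization of V, as the set of all nonzero
   multiples of v; it is meant for v != 0. *)
Definition proj_pt (V : lmodType K) (v : V) : set V :=
  [set c *: v | c in [set c : K | c != 0]].

(* The algebra endomorphism x |-> g_00 x + g_10 y, y |-> g_01 x + g_11 y: the
   columns of g are the images of the basis x, y, so g |-> gl_act g is a left
   action, and its restriction to forms of degree d is Sym^d(g). *)
Definition gl_act (g : 'M[K]_2) (F : {mpoly K[2]}) : {mpoly K[2]} :=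
  F \mPo [tuple \sum_(j < 2) g j i *: 'X_j | i < 2].

Definition PGL2 : set (set 'M[K]_2) :=
  [set proj_pt g | g in [set g : 'M[K]_2 | g \in unitmx]].

(* For homogeneous F of degree d, the forms (c *: g) . (c' *: F) are the
   c ^+ d * c' *: (g . F), c, c' != 0: the image of the point [F] under the
   class of g is the point [g . F]. *)
Definition pgl_act (phi : set 'M[K]_2) (P : set {mpoly K[2]}) :
    set {mpoly K[2]} :=
  [set gl_act g F | g in phi & F in P].

Definition distinct_triples (T : Type) (A : set T) : set (T * T * T) :=
  [set t | [/\ A t.1.1, A t.1.2 & A t.2] /\
           [/\ t.1.1 <> t.1.2, t.1.1 <> t.2 & t.1.2 <> t.2]].

Definition unity_roots (d : nat) : set K := [set z | z ^+ d = 1].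

Definition root_pt (xi : K) : set {mpoly K[2]} := proj_pt (xvar - xi *: yvar).

(* For pairwise distinct xi's and pairwise distinct points L of P(S_1) there
   is exactly one such phi, so xget returns it. *)
Definition interp_pgl (L : set {mpoly K[2]} * set {mpoly K[2]} * set {mpoly K[2]})
    (xi : K * K * K) : set 'M[K]_2 :=
  xget (proj_pt (1%:M : 'M[K]_2))
    [set phi | PGL2 phi /\
               [/\ pgl_act phi (root_pt xi.1.1) = L.1.1,
                   pgl_act phi (root_pt xi.1.2) = L.1.2 &
                   pgl_act phi (root_pt xi.2) = L.2]].

Definition Gamma (d : nat)
    (L : set {mpoly K[2]} * set {mpoly K[2]} * set {mpoly K[2]})
    (xi : K * K * K) : set {mpoly K[2]} :=
  pgl_act (interp_pgl L xi) (proj_pt (xvar ^+ d - yvar ^+ d)).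

End Forms.

Section Gap.
Variable R : realType.
Local Notation C := (complex R).

Definition complexify (F : {mpoly R[2]}) : {mpoly C[2]} :=
  map_mpoly (real_complex R) F.

Definition real_pts (d : nat) : set (set {mpoly C[2]}) :=
  [set proj_pt (complexify F) | F in @nonzero_forms R d].

Definition rank_gap (d : nat) (F : {mpoly R[2]}) : int :=
  (form_rank d F)%:Z - (form_rank d (complexify F))%:Z.

Definition max_gap_pts (d : nat) : set (set {mpoly C[2]}) :=
  [set proj_pt (complexify F) | F in
    [set F | nonzero_forms d F /\
             forall G, nonzero_forms d G -> rank_gap d G <= rank_gap d F]].

End Gap.

(* Main.v *)
Require Import Defs.
From HB Require Import structures.
From mathcomp Require Import all_boot all_order all_algebra all_field.
From mathcomp Require Import boolp classical_sets reals.
From mathcomp Require Import complex zify ring.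
From mathcomp Require Import mpoly.

Set Implicit Arguments.
Unset Strict Implicit.
Unset Printing Implicit Defensive.

Import Order.TTheory GRing.Theory Num.Theory.

Local Open Scope classical_set_scope.
Local Open Scope ring_scope.

(* Write L* for the complex conjugate of a linear form L. The real rank of a
   form of degree d is at most d, and a real form of complex rank 2 either is a
   sum of two real powers or has the shape c L^d + c* (L* )^d with L not
   proportional to L*. By apolarity the latter has real rank d, so the maximal
   gap is d - 2 and is attained exactly by these forms.
   A projectivity takes x^d - y^d to A^d - B^d, where A and B are the images of
   x and y. The three conditions that A - z B is proportional to a real form,
   for z a root of unity, say that a polynomial of degree 2 vanishes at three
   points z; its coefficients are the determinants of A, B, A*, B*, and their
   vanishing means B = nu A* with |nu| = 1. Up to a scalar, A^d - B^d is then of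
   the shape c A^d + c* (A* )^d. *)

(** * Coefficients of binary forms and of powers of linear forms *)

Section BinaryForms.
Variable K : numFieldType.
Implicit Types (F G : {mpoly K[2]}) (p q c : K) (d k m : nat).

Definition binom_mon k j : 'X_{1..2} := (U_(ord0) *+ k + U_(ord_max) *+ j)%MM.

Lemma binom_monE k j i : binom_mon k j i = if i == ord0 then k else j.
Proof.
rewrite /binom_mon mnmDE !mulmnE !mnm1E.
by case: i => [[|[|i]] Hi]; rewrite -?val_eqE /= ?(mul1n, mul0n, addn0).
Qed.

Lemma binom_mon_mdeg (m : 'X_{1..2}) : m = binom_mon (m ord0) (mdeg m - m ord0).
Proof.
apply/mnmP => i; rewrite binom_monE mdegE big_ord_recl big_ord1 addKn.
have [-> //|ne] := eqVneq i ord0; suff -> : i = lift ord0 ord0 by [].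
by apply/val_inj; case: i ne => [[|[|]]].
Qed.

(* The coefficients of F in the basis 'C(d, k) x^k y^(d-k), in which the power
   (p x + q y)^d has the coefficients p^k q^(d-k). *)
Definition bcoef d F k : K := F@_(binom_mon k (d - k)) / 'C(d, k)%:R.

Lemma bcoefD d k : {morph bcoef d ^~ k : F G / F + G}.
Proof. by move=> F G; rewrite /bcoef mcoeffD mulrDl. Qed.

Lemma bcoefZ d k c F : bcoef d (c *: F) k = c * bcoef d F k.
Proof. by rewrite /bcoef mcoeffZ mulrA. Qed.

Lemma bcoef0 d k : bcoef d 0 k = 0.
Proof. by rewrite /bcoef mcoeff0 mul0r. Qed.

Lemma bcoef_sum d k (I : Type) (r : seq I) (F : I -> {mpoly K[2]}) :
  bcoef d (\sum_(i <- r) F i) k = \sum_(i <- r) bcoef d (F i) k.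
Proof. exact: (big_morph (bcoef d ^~ k) (bcoefD d k) (bcoef0 d k)). Qed.

Lemma bcoefP d F G : F \is d.-homog -> G \is d.-homog ->
  (forall k, (k <= d)%N -> bcoef d F k = bcoef d G k) -> F = G.
Proof.
move=> hF hG e; apply/mpolyP => m.
have [em|ne] := eqVneq (mdeg m) d; last first.
  by rewrite (dhomog_nemf_coeff hF ne) (dhomog_nemf_coeff hG ne).
have lm : (m ord0 <= d)%N.
  by rewrite -em mdegE big_ord_recl big_ord1 leq_addr.
have := e _ lm; rewrite /bcoef -em -binom_mon_mdeg em.
by apply: mulIf; rewrite invr_eq0 pnatr_eq0 -lt0n bin_gt0.
Qed.

Definition lin p q : {mpoly K[2]} := p *: xvar K + q *: yvar K.

Lemma lin_homog p q : lin p q \is 1.-homog.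
Proof. by apply: dhomogD; apply: dhomogZ; rewrite dhomogX /= mdeg1. Qed.

Lemma linX_homog d p q : lin p q ^+ d \is d.-homog.
Proof. by rewrite -[X in X.-homog]mul1n dhomogMn ?lin_homog. Qed.

Lemma bcoef_linX d p q k : (k <= d)%N ->
  bcoef d (lin p q ^+ d) k = p ^+ k * q ^+ (d - k).
Proof.
move=> le_kd; rewrite /bcoef /lin exprDn linear_sum /=.
(* The index in [exprDn] counts the factors q y, so the monomial with x^k is the term of index d -
   k. *)
have lt : (d - k < d.+1)%N by rewrite ltnS leq_subr.
rewrite (bigD1 (Ordinal lt)) //= big1 ?addr0.
  rewrite !exprZn -scalerAl -scalerAr scalerA mcoeffMn mcoeffZ.
  rewrite /xvar /yvar !mpolyXn -mpolyXD mcoeffX subKn // /binom_mon eqxx mulr1.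
  by rewrite bin_sub // -[_ *+ _]mulr_natr mulfK // pnatr_eq0 -lt0n bin_gt0.
move=> i ne; rewrite !exprZn -scalerAl -scalerAr scalerA mcoeffMn mcoeffZ.
rewrite /xvar /yvar !mpolyXn -mpolyXD mcoeffX.
case: eqP => [/mnmP/(_ ord_max)|_]; last by rewrite mulr0 mul0rn.
rewrite -!/(binom_mon _ _) !binom_monE /= => e; case/eqP: ne.
by apply/val_inj.
Qed.

Lemma bcoef_lin p q : bcoef 1 (lin p q) 1 = p /\ bcoef 1 (lin p q) 0 = q.
Proof.
by rewrite -(expr1 (lin p q)) !bcoef_linX //= expr0 !expr1 mulr1 mul1r.
Qed.

Lemma homog1_lin F : F \is 1.-homog -> F = lin (bcoef 1 F 1) (bcoef 1 F 0).
Proof.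
move=> hF; apply: (bcoefP hF (lin_homog _ _)) => k.
by have [e1 e0] := bcoef_lin (bcoef 1 F 1) (bcoef 1 F 0); case: k => [|[|]].
Qed.

Lemma lin_inj p q p' q' : lin p q = lin p' q' -> p = p' /\ q = q'.
Proof.
by move=> e; have [] := bcoef_lin p q; rewrite e; have [-> ->] := bcoef_lin p' q'.
Qed.

Lemma lin0 : lin 0 0 = 0.
Proof. by rewrite /lin !scale0r addr0. Qed.

Lemma lin_neq0 p q : (lin p q != 0) = ((p, q) != (0, 0)).
Proof.
congr (~~ _); apply/eqP/eqP => [|[-> ->]]; last exact: lin0.
by rewrite -lin0 => /lin_inj[-> ->].
Qed.

Lemma linD p q p' q' : lin p q + lin p' q' = lin (p + p') (q + q').
Proof. by rewrite /lin !scalerDl addrACA. Qed.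

Lemma linZ c p q : c *: lin p q = lin (c * p) (c * q).
Proof. by rewrite /lin scalerDr !scalerA. Qed.

(** Every L_i is some [lin p q], so a decomposition amounts to d + 1 scalar equations. The rank
    arguments below are carried out on these equations. *)
Lemma power_sumP d F m : F \is d.-homog ->
  power_sum d F m <-> exists a p q : 'I_m -> K, forall k, (k <= d)%N ->
    bcoef d F k = \sum_(i < m) a i * (p i ^+ k * q i ^+ (d - k)).
Proof.
move=> hF; split => [[a [L [hL eF]]]|[a [p [q e]]]].
  exists a, (fun i => bcoef 1 (L i) 1), (fun i => bcoef 1 (L i) 0) => k le_kd.
  rewrite eF bcoef_sum; apply: eq_bigr => i _.
  by rewrite bcoefZ {1}(homog1_lin (hL i)) bcoef_linX.
exists a, (fun i => lin (p i) (q i)); split => [i|]; first exact: lin_homog.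
apply: (bcoefP hF) => [|k le_kd].
  by apply: rpred_sum => i _; apply: rpredZ; apply: linX_homog.
rewrite e // bcoef_sum; apply: eq_bigr => i _.
by rewrite bcoefZ bcoef_linX.
Qed.

End BinaryForms.

(** * The apolar pairing, and decompositions into d powers *)

Section PolynomialPairing.
Variable K : numFieldType.
Implicit Types (f : nat -> K) (g h : {poly K}) (d k m n : nat).

(* The linear functional on polynomials with the moments f k; it is the
   apolar pairing of g with the form that has the coefficients f. *)
Definition moment f g : K := \sum_(k < size g) g`_k * f k.

Lemma momentE n f g : (size g <= n)%N -> moment f g = \sum_(k < n) g`_k * f k.
Proof.
move=> le_gn; rewrite /moment (big_ord_widen n (fun k => g`_k * f k) le_gn).
rewrite big_mkcond; apply: eq_bigr => k _; case: ltnP => // le_gk.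
by rewrite nth_default ?mul0r.
Qed.

Lemma moment_is_linear f : scalable_for *%R (moment f) * zmod_morphism (moment f).
Proof.
split=> [c g | g h].
  rewrite (momentE f (size_scale_leq c g)) /moment big_distrr /=.
  by apply: eq_bigr => k _; rewrite coefZ mulrA.
set n := maxn (size g) (size h).
rewrite !(@momentE n) ?leq_maxl ?leq_maxr //; last first.
  by rewrite (leq_trans (size_polyD _ _)) // size_polyN.
by rewrite -sumrB; apply: eq_bigr => k _; rewrite coefB mulrBl.
Qed.

HB.instance Definition _ f :=
  GRing.isZmodMorphism.Build {poly K} K (moment f) (moment_is_linear f).2.
HB.instance Definition _ f :=
  GRing.isScalable.Build K {poly K} K *%R (moment f) (moment_is_linear f).1.

Lemma eq_moment n f f' g : (size g <= n)%N ->
  (forall k, (k < n)%N -> f k = f' k) -> moment f g = moment f' g.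
Proof.
move=> le_gn e; apply: eq_bigr => k _; rewrite e //.
exact: leq_trans (ltn_ord k) le_gn.
Qed.

Lemma moment_sum (I : Type) (r : seq I) (F : I -> nat -> K) g :
  moment (fun k => \sum_(i <- r) F i k) g = \sum_(i <- r) moment (F i) g.
Proof.
by rewrite exchange_big; apply: eq_bigr => k _; rewrite mulr_sumr.
Qed.

Lemma momentZ c f g : moment (fun k => c * f k) g = c * moment f g.
Proof. by rewrite mulr_sumr; apply: eq_bigr => k _; rewrite mulrCA. Qed.

Lemma moment_expr p g : moment (fun k => p ^+ k) g = g.[p].
Proof. by rewrite horner_coef. Qed.

(** In characteristic 0 the natural numbers below [size g] are distinct and outnumber the possible
    roots. This provides the generic shift in [power_decomposition]. *)
Lemma ex_nonroot g : g != 0 -> exists x, g.[x] != 0.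
Proof.
move=> g0; apply: contrapT => all0.
have natI : injective (fun k => k%:R : K) by move=> i j /eqP; rewrite eqr_nat => /eqP.
have := @max_poly_roots _ _ (mkseq (fun k => k%:R : K) (size g)) g0.
rewrite mkseq_uniq // size_mkseq ltnn => H; suff: false by []; apply: H => //.
apply/allP => x _; apply/rootP; apply: contrapT => gx; apply: all0; exists x.
exact/eqP.
Qed.

(** Taylor's formula in Hasse derivatives, which makes the moments of the translates of g polynomial
    in the shift s. *)
Lemma comp_polyXaddC g (s : K) :
  g \Po ('X + s%:P) = \sum_(i < size g) s ^+ i *: g^`N(i).
Proof.
rewrite /comp_poly nderiv_taylor; last exact: mulrC.
rewrite size_map_polyC; apply: eq_bigr => i _.
rewrite nderivn_map -/(comp_poly 'X _) comp_polyXr -rmorphXn /=.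
by rewrite mulrC mul_polyC.
Qed.

(* The Hasse derivatives of a polynomial of degree m are a basis of the
   polynomials of degree at most m, so the moments of the translates of h do
   not all vanish. *)
Lemma moment_translate f h m k : size h = m.+1 -> (k <= m)%N -> f k != 0 ->
  exists2 Q : {poly K}, Q != 0 &
    forall s, Q.[s] = moment f (h \Po ('X + s%:P)).
Proof.
move=> sh; elim/ltn_ind: k => k IH le_km fk.
have [[j [lt_jk fj]]|min_k] :=
    pselect (exists j, (j < k)%N /\ f j != 0).
  by apply: (IH j) => //; apply: leq_trans (ltnW lt_jk) le_km.
exists (\poly_(i < m.+1) moment f h^`N(i)); last first.
  move=> s; rewrite comp_polyXaddC linear_sum sh horner_poly.
  by apply: eq_bigr => i _; rewrite linearZ mulrC.
(* Here k is the least index with f k nonzero. The Hasse derivative of order m - k has degree k, so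
   only its leading coefficient meets a nonzero moment. *)
apply/eqP => /polyP/(_ (m - k)%N).
rewrite coef_poly coef0 ltnS leq_subr => /eqP; apply/negP.
have sz : (size h^`N(m - k) <= k.+1)%N.
  by apply/leq_sizeP => j lt_kj; rewrite coef_nderivn nth_default ?mul0rn // sh; lia.
rewrite (momentE f sz) big_ord_recr /= big1 ?add0r; last first.
  move=> i _; suff -> : f i = 0 by rewrite mulr0.
  by apply: contrapT => /eqP fi; apply: min_k; exists i.
rewrite coef_nderivn subnK // mulf_neq0 // mulrn_eq0 negb_or.
rewrite -lt0n bin_gt0 leq_subr /=.
have <- : (size h).-1 = m by rewrite sh.
by rewrite -lead_coefE lead_coef_eq0 -size_poly_eq0 sh.
Qed.

Lemma vandermonde_solve d (t : 'I_d -> K) (b : 'I_d -> K) : injective t ->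
  exists a : 'I_d -> K, forall k : 'I_d, b k = \sum_(i < d) a i * t i ^+ k.
Proof.
move=> t_inj; pose V := Vandermonde d (\row_i t i).
have uV : V \in unitmx.
  rewrite unitmxE det_Vandermonde unitfE prodf_seq_neq0; apply/allP => i _ /=.
  rewrite prodf_seq_neq0; apply/allP => j _ /=; apply/implyP => lt_ij.
  by rewrite !mxE subr_eq0; apply/eqP => /t_inj e; rewrite e ltnn in lt_ij.
exists (fun i => (invmx V *m \col_j b j) i 0) => k.
have /matrixP/(_ k 0) := mulKVmx uV (\col_j b j).
rewrite [RHS]mxE => <-; rewrite mxE; apply: eq_bigr => i _.
by rewrite !mxE mulrC.
Qed.

(* Nodes are chosen as the roots of a polynomial of degree d that is killed by
   moment f; all but one of them are taken from a generic arithmetic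
   progression, and the condition on the last one is linear. *)
Lemma power_decomposition d f : (0 < d)%N ->
  exists a p q : 'I_d -> K, forall k, (k <= d)%N ->
    f k = \sum_(i < d) a i * (p i ^+ k * q i ^+ (d - k)).
Proof.
case: d => // n _; pose d := n.+1; rewrite -/d.
have [[k0 [lt_k0 fk0]]|f0] := pselect (exists k, (k < d)%N /\ f k != 0); last first.
  (* When f vanishes below d, the form is f_d x^d, and the other d - 1 powers get the coefficient
     0. *)
  exists (fun i => if i == ord0 then f d else 0), (fun=> 1), (fun=> 0) => k le_kd.
  rewrite big_ord_recl big1 ?addr0 => [|i _]; last by rewrite mul0r.
  rewrite /= expr1n mul1r expr0n subn_eq0.
  have [le_dk|lt_kd] := leqP d k.
    by rewrite /= mulr1; congr f; apply/eqP; rewrite eqn_leq le_kd.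
  rewrite mulr0; apply: contrapT => /eqP fk; apply: f0; by exists k.
pose h := \prod_(j <- index_enum 'I_n) ('X - ((j : nat)%:R : K)%:P).
have sh : size h = n.+1 by rewrite size_prod_XsubC [index_enum _]unlock -enumT size_enum_ord.
have [Q Q0 QE] := moment_translate sh (ltnSE lt_k0) fk0.
have shi (i : 'I_n) : size (h * ('X - ((i : nat)%:R : K)%:P)) = d.+1.
  by rewrite size_Mmonic ?monicXsubC -?size_poly_eq0 ?sh // size_XsubC addn2.
have /choice[Qi QiP] (i : 'I_n) : exists Qi : {poly K}, Qi != 0 /\ forall s,
    Qi.[s] = moment f ((h * ('X - ((i : nat)%:R : K)%:P)) \Po ('X + s%:P)).
  by have [q q0 qE] := moment_translate (shi i) (ltnW lt_k0) fk0; exists q.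
(* At such a shift s, the factor Q makes the denominator of [tau] nonzero, and each Qi keeps [tau]
   away from the node i - s. *)
have [] := @ex_nonroot (Q * \prod_i Qi i).
  by rewrite mulf_neq0 //; apply/prodf_neq0 => i _; case: (QiP i).
move=> s; rewrite hornerM mulf_eq0 negb_or horner_prod => /andP[].
rewrite QE => hs0 /prodf_neq0 his0; pose hs := h \Po ('X + s%:P).
(* The last node is the solution of the linear equation moment f (hs (X - tau)) = 0. *)
pose tau := moment f (hs * 'X) / moment f hs.
pose t (i : 'I_d) := if unlift ord_max i is Some j then (j : nat)%:R - s else tau.
have shiftX c : ('X - c%:P) \Po ('X + s%:P) = 'X - (c - s)%:P.
  by rewrite comp_polyB comp_polyX comp_polyC polyCB opprB addrA.
have hsE : hs = \prod_(j < n) ('X - ((j : nat)%:R - s)%:P).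
  rewrite /hs /h rmorph_prod; apply: eq_bigr => j _ /=.
  exact: shiftX.
have momXsub c : moment f (hs * ('X - c%:P)) = (tau - c) * moment f hs.
  rewrite mulrBr linearB /= mulrBl mulfVK //; congr (_ - _).
  by rewrite mulrC mul_polyC linearZ.
have tau_ne (j : 'I_n) : tau != j%:R - s.
  have := his0 j isT; have [_ ->] := QiP j.
  by rewrite rmorphM /= shiftX -/hs momXsub mulf_eq0 negb_or subr_eq0 => /andP[].
have t_inj : injective t.
  move=> i j; rewrite /t; case: unliftP => [i' ->|->]; case: unliftP => [j' ->|->] //.
  - by move=> /addIr/eqP; rewrite eqr_nat => /eqP/val_inj ->.
  - by move=> e; have := tau_ne i'; rewrite e eqxx.
  - by move=> e; have := tau_ne j'; rewrite e eqxx.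
(* The Vandermonde system settles the indices below d. The index d follows because W is monic of
   degree d and is killed by the moments of both f and f'. *)
have [a aP] := vandermonde_solve (fun k : 'I_d => f k) t_inj.
exists a, t, (fun=> 1) => k; pose f' k := \sum_(i < d) a i * t i ^+ k.
rewrite leq_eqVlt => /predU1P[->|lt_kd]; last first.
  by rewrite (aP (Ordinal lt_kd)); apply: eq_bigr => i _; rewrite expr1n mulr1.
under eq_bigr do rewrite expr1n mulr1; rewrite -/(f' d).
pose W := hs * ('X - tau%:P).
have WE : W = \prod_(i < d) ('X - (t i)%:P).
  rewrite big_ord_recr /= {2}/t unlift_none; congr (_ * _).
  rewrite hsE; apply: eq_bigr => i _; rewrite /t.
  have -> : widen_ord (leqnSn n) i = lift ord_max i.
    by apply/val_inj; rewrite /= /bump leqNgt ltn_ord.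
  by rewrite liftK.
have W0 : moment f W = 0 by rewrite momXsub subrr mul0r.
have W'0 : moment f' W = 0.
  rewrite moment_sum big1 // => i _; rewrite momentZ moment_expr WE horner_prod.
  by rewrite (bigD1 i) //= hornerXsubC subrr mul0r mulr0.
have sW : size W = d.+1.
  by rewrite WE size_prod_XsubC [index_enum _]unlock -enumT size_enum_ord.
have Wd : W`_d = 1.
  have /monicP : W \is monic by rewrite WE monic_prod_XsubC.
  by rewrite lead_coefE sW.
move: W0; rewrite -W'0 /moment sW !(big_ord_recr d) /= Wd !mul1r.
rewrite (eq_bigr (fun k : 'I_d => W`_k * f' k)) => [/addrI //|i _].
by rewrite (aP i).
Qed.

End PolynomialPairing.

(** * Linear relations among d-th powers *)

Section PowerRelations.
Variable K : numFieldType.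
Implicit Types (P Q w : K * K) (g : {poly K}) (d k : nat).

(** For k at most d, these are the [bcoef] coefficients of the power (P.1 x + P.2 y)^d. *)
Definition lpow d P k : K := P.1 ^+ k * P.2 ^+ (d - k).

Definition wedge P Q : K := P.1 * Q.2 - P.2 * Q.1.

Definition eval_at w P : K := w.1 * P.1 + w.2 * P.2.

Lemma momentMX (f : nat -> K) g : moment f (g * 'X) = moment (fun k => f k.+1) g.
Proof.
have sz : (size (g * 'X)%R <= (size g).+1)%N.
  by rewrite (leq_trans (size_polyMleq _ _)) // size_polyX addn2.
rewrite (momentE _ sz) big_ord_recl coefMX mul0r add0r.
by apply: eq_bigr => k _; rewrite coefMX.
Qed.

(** Apolarity of a d-th power with a product of d linear factors. Multiplication by X raises the
    index and contributes P.1, a constant term contributes P.2, so each factor contributes its value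
    at P. *)
Lemma moment_lpow_prod (s : seq (K * K)) P :
  let g := \prod_(w <- s) (w.1 *: 'X + w.2%:P) in
  (size g <= (size s).+1)%N /\
  moment (lpow (size s) P) g = \prod_(w <- s) eval_at w P.
Proof.
elim: s => [|w s [sz IH]] /=.
  rewrite !big_nil size_poly1; split=> //.
  by rewrite /moment size_poly1 big_ord1 coef1 /lpow !expr0 !mulr1.
rewrite !big_cons; set g := \prod_(w <- s) _ in sz IH *; set d := size s in sz IH *.
have size_lin : (size (w.1 *: 'X + w.2%:P)%R <= 2)%N.
  rewrite (leq_trans (size_polyD _ _)) // geq_max.
  rewrite (leq_trans (size_scale_leq _ _)) ?size_polyX //.
  by rewrite (leq_trans (size_polyC_leq1 _)).
split.
  by rewrite (leq_trans (size_polyMleq _ _)) // -subn1 leq_subLR (leq_add size_lin sz).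
rewrite mulrDl linearD /= -scalerAl linearZ /= mulrC [X in moment _ X]mulrC.
rewrite mul_polyC linearZ /= -IH /eval_at mulrDl momentMX.
rewrite (eq_moment (f' := fun k => P.1 * lpow d P k) sz) => [|k lt_kd].
  rewrite [moment (lpow d.+1 P) g](eq_moment (f' := fun k => P.2 * lpow d P k) sz)
    => [|k lt_kd].
    by rewrite !momentZ; ring.
  by rewrite /lpow subSn // exprS mulrCA.
by rewrite /lpow subSS exprS mulrA.
Qed.

(** This is the independence of at most d + 1 powers of pairwise non-proportional linear forms. If P
    were proportional to no other nonzero entry, a product of d linear factors vanishing at all
    other entries but not at P would contradict the relation. *)
Lemma power_relation d a P (s : seq (K * (K * K))) :
  (size s <= d)%N -> a != 0 -> P != (0, 0) ->
  (forall k, (k <= d)%N -> \sum_(t <- (a, P) :: s) t.1 * lpow d t.2 k = 0) ->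
  exists t, [/\ t \in s, t.2 != (0, 0) & wedge P t.2 = 0].
Proof.
move=> le_sd a0 P0 rel; apply: contrapT => no_t.
(* The factor [pad] does not vanish at P. It brings the number of factors up to d and serves for the
   entries with zero vector, at which every factor vanishes. *)
pose pad : K * K := if P.1 != 0 then (1, 0) else (0, 1).
have padP : eval_at pad P != 0.
  rewrite /eval_at /pad; have [p0|p0] := eqVneq P.1 0.
    rewrite /= mul0r mul1r add0r; apply: contraNneq P0 => q0.
    by rewrite [P]surjective_pairing p0 q0.
  by rewrite /= mul1r mul0r addr0.
pose w (t : K * (K * K)) : K * K := if t.2 == (0, 0) then pad else (t.2.2, - t.2.1).
pose ws := map w s ++ nseq (d - size s) pad.
have sws : size ws = d by rewrite size_cat size_map size_nseq subnKC.
have [szg _] := moment_lpow_prod ws (0, 0).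
set g := (\prod_(w <- ws) _) in szg.
have : moment (fun k => \sum_(t <- (a, P) :: s) t.1 * lpow d t.2 k) g = 0.
  rewrite (@eq_moment _ d.+1 _ (fun=> 0)) ?sws // /moment -?sws //.
  by rewrite big1 // => i _; rewrite mulr0.
have momg Q : moment (lpow d Q) g = \prod_(w <- ws) eval_at w Q.
  by rewrite -sws; have [_ ->] := moment_lpow_prod ws Q.
rewrite moment_sum big_cons big1_seq /= => [|t /= ts].
  rewrite addr0 momentZ momg; apply/eqP; rewrite mulf_neq0 //.
  rewrite prodf_seq_neq0; apply/allP => w'; rewrite implyTb mem_cat => /orP[/mapP[t ts ->]|].
    rewrite /w; have [//|t0] := eqVneq t.2 (0, 0).
    apply/eqP => e; apply: no_t; exists t; split=> //.
    by rewrite -e /wedge /eval_at /=; ring.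
  by rewrite mem_nseq => /andP[_ /eqP ->].
rewrite momentZ momg big_cat big_map (big_rem t ts) /=.
suff -> : eval_at (w t) t.2 = 0 by rewrite !mul0r mulr0.
rewrite /w /eval_at; case: eqVneq => [->|_] /=; first by rewrite !mulr0 addr0.
by ring.
Qed.

End PowerRelations.

(** * Proportionality of coordinate vectors *)

Section PointWedge.
Variable K : numFieldType.
Implicit Types P Q : K * K.

Lemma wedge_sym P Q : wedge P Q = - wedge Q P.
Proof. by rewrite /wedge opprB [P.2 * _]mulrC [P.1 * _]mulrC. Qed.

Lemma wedge_trans P P' Q : Q != (0, 0) -> wedge P Q = 0 -> wedge P' Q = 0 ->
  wedge P P' = 0.
Proof.
rewrite /wedge => Q0 /eqP; rewrite subr_eq0 => /eqP e /eqP; rewrite subr_eq0 => /eqP e'.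
have [q1|q1] := eqVneq Q.1 0.
  have q2 : Q.2 != 0.
    by apply: contraNneq Q0 => q2; rewrite [Q]surjective_pairing q1 q2.
  move/eqP: e; rewrite q1 mulr0 mulf_eq0 (negPf q2) orbF => /eqP ->.
  by move/eqP: e'; rewrite q1 mulr0 mulf_eq0 (negPf q2) orbF => /eqP ->; ring.
apply: (mulIf q1); rewrite mul0r mulrBl -mulrA -e' mulrA [P.2 * _ * _]mulrAC -e.
by ring.
Qed.

Lemma wedge0_scale P Q : P != (0, 0) -> wedge P Q = 0 ->
  exists c, Q = (c * P.1, c * P.2).
Proof.
rewrite /wedge => P0 /eqP; rewrite subr_eq0 => /eqP e.
have [p1|p1] := eqVneq P.1 0.
  have p2 : P.2 != 0.
    by apply: contraNneq P0 => p2; rewrite [P]surjective_pairing p1 p2.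
  exists (Q.2 / P.2); rewrite p1 mulr0 divfK // [LHS]surjective_pairing.
  by move/eqP: e; rewrite p1 mul0r eq_sym mulf_eq0 (negPf p2) => /eqP ->.
exists (Q.1 / P.1); rewrite divfK // mulrAC [Q.1 * _]mulrC -e.
by rewrite mulrAC divff // mul1r -surjective_pairing.
Qed.

Lemma wedge_neq0 P Q : wedge P Q != 0 -> P != (0, 0).
Proof. by apply: contraNneq => ->; rewrite /wedge !mul0r subr0. Qed.

Lemma lpowZ d c P k : (k <= d)%N ->
  lpow d (c * P.1, c * P.2) k = c ^+ d * lpow d P k.
Proof.
by move=> le_kd; rewrite /lpow !exprMn -{3}(subnKC le_kd) exprD; ring.
Qed.

End PointWedge.

(** * Real forms as sums of real and of complex powers *)

Section RealAndComplexSums.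
Variable R : realType.
Local Notation C := (R[i]).
Local Notation toC := (real_complex R).
Implicit Types (f : nat -> R) (P Q : C * C) (c : C).

Definition cpt P : C * C := (P.1^*, P.2^*).

Lemma cptK P : cpt (cpt P) = P.
Proof. by rewrite /cpt !conjCK -surjective_pairing. Qed.

Lemma wedge_cpt P Q : wedge (cpt P) (cpt Q) = (wedge P Q)^*.
Proof. by rewrite /wedge rmorphB !rmorphM. Qed.

Lemma lpow_cpt d P k : lpow d (cpt P) k = (lpow d P k)^*.
Proof. by rewrite /lpow rmorphM !rmorphXn. Qed.

Lemma conj_toC (r : R) : (toC r)^* = toC r.
Proof. by apply/eqP; rewrite eq_complex /= oppr0 !eqxx. Qed.

Lemma Re_mul_toC c (r : R) : complex.Re (c * toC r) = complex.Re c * r.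
Proof. by case: c => a b /=; rewrite mulr0 subr0. Qed.

Lemma ReD (z w : C) : complex.Re (z + w) = complex.Re z + complex.Re w.
Proof. by case: z w => [a b] []. Qed.

Lemma conj_fixed c : c^* = c -> exists r, c = toC r.
Proof.
case: c => a b [] /eqP; rewrite eq_sym -subr_eq0 opprK -mulr2n mulrn_eq0 /=.
by move=> /eqP ->; exists a.
Qed.

(** If P.1 is nonzero, the condition says that P.2 / P.1 is fixed by conjugation. *)
Lemma real_pointP P : wedge P (cpt P) = 0 ->
  exists c (r : R * R), P = (c * toC r.1, c * toC r.2).
Proof.
rewrite /wedge /= => /eqP; rewrite subr_eq0 => /eqP e.
have [p1|p1] := eqVneq P.1 0.
  by exists P.2, (0, 1); rewrite /= mulr0 mulr1 -[in RHS]p1 -surjective_pairing.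
have [] := @conj_fixed (P.2 / P.1).
  apply/eqP; rewrite fmorph_div eqr_div ?fmorph_eq0 // ?conjC_eq0 //.
  by rewrite mulrC e.
move=> r er; exists P.1, (1, r); rewrite /= mulr1 -er mulrC divfK //.
exact: surjective_pairing.
Qed.

(* A decomposition a_1 L_1^d + ... + a_m L_m^d given by the pairs of a_i and
   the coordinates of L_i. *)
Definition lin_sum (K : numFieldType) d (f : nat -> K) (s : seq (K * (K * K))) :=
  forall k, (k <= d)%N -> f k = \sum_(t <- s) t.1 * lpow d t.2 k.

Definition has_sum (K : numFieldType) d (f : nat -> K) m :=
  exists2 s, size s = m & lin_sum d f s.

Lemma has_sum_leq (K : numFieldType) d (f : nat -> K) m n :
  (m <= n)%N -> has_sum d f m -> has_sum d f n.
Proof.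
move=> le_mn [s sz e]; exists (s ++ nseq (n - m) (0, (0, 0))).
  by rewrite size_cat size_nseq sz subnKC.
move=> k le_kd; rewrite big_cat /= [X in _ + X]big1_seq ?addr0 ?e // => t.
by rewrite mem_nseq => /andP[_ /andP[_ /eqP ->]]; rewrite mul0r.
Qed.

(** Each power is a complex multiple of a real one. As f is real, taking real parts of the
    coefficients keeps the sum and its length. *)
Lemma real_has_sum d f (s : seq (C * (C * C))) :
  lin_sum d (toC \o f) s -> (forall t, t \in s -> wedge t.2 (cpt t.2) = 0) ->
  has_sum d f (size s).
Proof.
move=> e h.
have : exists s', size s' = size s /\ forall k, (k <= d)%N ->
    complex.Re (\sum_(t <- s) t.1 * lpow d t.2 k) = \sum_(t <- s') t.1 * lpow d t.2 k.
  elim: s h {e} => [|t s IH] h; first by exists [::]; split=> // k; rewrite !big_nil.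
  have [|s' [sz es']] := IH; first by move=> u us; apply: h; rewrite inE us orbT.
  have [|c [r er]] := @real_pointP t.2; first by apply: h; rewrite inE eqxx.
  exists ((complex.Re (t.1 * c ^+ d), r) :: s'); split; rewrite /= ?sz // => k le_kd.
  rewrite !big_cons -es' // ReD; congr (_ + _).
  rewrite er (lpowZ c (toC r.1, toC r.2)) // mulrA -Re_mul_toC; congr (complex.Re (_ * _)).
  by rewrite /lpow rmorphM !rmorphXn.
case=> s' [sz e']; exists s' => // k le_kd.
by rewrite -e' // -e.
Qed.

Definition conj_sum d f c P := [/\ c != 0, wedge P (cpt P) != 0 &
  forall k, (k <= d)%N -> toC (f k) = c * lpow d P k + c^* * lpow d (cpt P) k].

(** With m < d real powers, equating both expressions gives a relation among at most d + 1 powers.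
    It makes P proportional to its conjugate or to a real point, and either contradicts the
    determinant condition on P. *)
Lemma conj_sum_real_rank d f c P m :
  conj_sum d f c P -> has_sum d f m -> (d <= m)%N.
Proof.
move=> [c0 wP e] [s sz es]; rewrite leqNgt; apply/negP => lt_md.
pose cs := [seq (- toC t.1, (toC t.2.1, toC t.2.2)) | t <- s].
have [|k le_kd|[w Q] [/=]] :=
    @power_relation _ d c P ((c^*, cpt P) :: cs) _ c0 (wedge_neq0 wP).
- by rewrite /= size_map sz.
- rewrite !big_cons /= addrA -e // es // raddf_sum big_map /= -big_split big1 //= => t _.
  by rewrite mulNr rmorphM /lpow rmorphM !rmorphXn subrr.
rewrite inE => /predU1P[[_ ->] _ w0|]; first by rewrite w0 eqxx in wP.
case/mapP => t _ [_ ->] Q0 w0.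
case/eqP: wP; apply: (wedge_trans Q0 w0).
have := wedge_cpt P (toC t.2.1, toC t.2.2).
by rewrite w0 conjC0 /cpt /= !conj_toC.
Qed.

(** If one power of Q sufficed, the relation of three powers would make both P and its conjugate
    proportional to Q. *)
Lemma conj_sum_complex_rank d f c P m : (1 < d)%N ->
  conj_sum d f c P -> has_sum d (toC \o f) m -> (1 < m)%N.
Proof.
move=> d1 [c0 wP e] hm; rewrite ltnNge; apply/negP => le_m1.
have [s sz es] := has_sum_leq le_m1 hm; case: s sz es => [|[a Q] [|//]] // _ es.
have wP' : wedge (cpt P) P != 0 by rewrite wedge_sym oppr_eq0.
have rel k : (k <= d)%N -> c * lpow d P k + c^* * lpow d (cpt P) k - a * lpow d Q k = 0.
  by move=> le_kd; have := es _ le_kd; rewrite big_seq1 /= -e // => ->; rewrite subrr.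
have [|k le_kd|[w Q1] [/=]] :=
    @power_relation _ d c P [:: (c^*, cpt P); (- a, Q)] _ c0 (wedge_neq0 wP) => //.
  by rewrite !big_cons big_nil /= addr0 addrA mulNr rel.
rewrite !inE => /orP[/eqP[_ ->] _ /eqP|/eqP[_ ->] Q0 w0]; first by rewrite (negPf wP).
have [||k le_kd|[w' Q2] [/=]] :=
    @power_relation _ d c^* (cpt P) [:: (c, P); (- a, Q)] _ _ (wedge_neq0 wP') => //.
- by rewrite conjC_eq0.
- by rewrite !big_cons big_nil /= addr0 addrA mulNr [X in X - _]addrC rel.
rewrite !inE => /orP[/eqP[_ ->] _ /eqP|/eqP[_ ->] _ w1]; first by rewrite (negPf wP').
by case/eqP: wP; apply: (wedge_trans Q0 w0 w1).
Qed.

Lemma conj_sum_has2 d f c P : conj_sum d f c P -> has_sum d (toC \o f) 2.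
Proof.
move=> [_ _ e]; exists [:: (c, P); (c^*, cpt P)] => // k le_kd.
by rewrite !big_cons big_nil /= addr0 e.
Qed.

(** A real form equals its conjugate; comparing the two powers makes P proportional to its conjugate
    unless the coefficient is zero. *)
Lemma has_sum1_real d f : (0 < d)%N -> has_sum d (toC \o f) 1 -> has_sum d f 1.
Proof.
move=> d0 [[|[a P] [|//]] // _ e].
have [wP|wP] := eqVneq (wedge P (cpt P)) 0.
  by apply: (real_has_sum e) => t; rewrite inE => /eqP ->.
have [a0|a0] := eqVneq a 0.
  exists [:: (0, (0, 0))] => // k le_kd; have := e _ le_kd.
  by rewrite !big_seq1 a0 !mul0r /= => -[].
have [|k le_kd|[w Q] [/=]] :=
  @power_relation _ d a P [:: (- a^*, cpt P)] _ a0 (wedge_neq0 wP) => //.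
  rewrite !big_cons big_nil /= addr0 mulNr lpow_cpt -rmorphM /=.
  have := e _ le_kd; rewrite big_seq1 /= => <-.
  by rewrite conj_toC subrr.
by rewrite inE => /eqP[_ ->] _ /eqP; rewrite (negPf wP).
Qed.

Lemma has_sum_swap (K : numFieldType) d (f : nat -> K) t u :
  lin_sum d f [:: t; u] -> lin_sum d f [:: u; t].
Proof. by move=> e k le_kd; rewrite e // !big_cons big_nil !addr0 addrC. Qed.

(** Subtracting the conjugate equation gives a relation among four powers, which is why d > 2 is
    assumed. As P is not real, it is proportional to Q, and the two powers merge, or to the
    conjugate of Q. *)
Lemma has_sum1_or_conj_sum d f a P b Q : (2 < d)%N -> a != 0 ->
  wedge P (cpt P) != 0 -> lin_sum d (toC \o f) [:: (a, P); (b, Q)] ->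
  has_sum d (toC \o f) 1 \/ exists c P, conj_sum d f c P.
Proof.
move=> d2 a0 wP e.
have [|k le_kd|[w T] [/=]] := @power_relation _ d a P
    [:: (b, Q); (- a^*, cpt P); (- b^*, cpt Q)] _ a0 (wedge_neq0 wP) => //.
  have := e _ le_kd; rewrite !big_cons !big_nil /= !addr0 => ek.
  rewrite addrA -ek !mulNr !lpow_cpt -!rmorphM -opprD -rmorphD -ek /=.
  by rewrite conj_toC subrr.
rewrite !inE => /or3P[]/eqP[_ ->] Q0.
- move=> /(wedge0_scale (wedge_neq0 wP))[c eQ]; left.
  exists [:: (a + b * c ^+ d, P)] => // k le_kd.
  by rewrite e // !big_cons !big_nil /= eQ lpowZ //; ring.
- by move/eqP; rewrite (negPf wP).
move=> /(wedge0_scale (wedge_neq0 wP))[c eQ]; right.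
have eQ' : Q = (c^* * (cpt P).1, c^* * (cpt P).2).
  by rewrite -(cptK Q) eQ /cpt /= !rmorphM.
set b' := b * (c^*) ^+ d.
have ek k : (k <= d)%N -> toC (f k) = a * lpow d P k + b' * lpow d (cpt P) k.
  move=> le_kd; have := e _ le_kd; rewrite /= => ->.
  by rewrite !big_cons !big_nil /= addr0 eQ' lpowZ // mulrA.
(* Invariance under conjugation also fixes the second coefficient, as the powers of P and of its
   conjugate are independent. *)
suff eb : b' = a^* by exists a, P; split=> // k le_kd; rewrite ek // eb.
apply: contrapT => /eqP ne.
have ne' : a - b'^* != 0.
  by apply: contraNneq ne => /eqP; rewrite subr_eq0 => /eqP ->; rewrite conjCK.
have [|k le_kd|[w' T'] [/=]] := @power_relation _ d (a - b'^*) P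
    [:: (b' - a^*, cpt P)] _ ne' (wedge_neq0 wP) => //.
- by apply: leq_trans d2.
- rewrite !big_cons !big_nil /= addr0.
  have := conj_toC (f k); rewrite ek // rmorphD (rmorphM _ a) (rmorphM _ b') /=.
  rewrite -!lpow_cpt cptK => h.
  rewrite !mulrBl addrACA -opprD [X in _ - X]addrC h; exact: subrr.
by rewrite inE => /eqP[_ ->] _ /eqP; rewrite (negPf wP).
Qed.

Lemma has_sum2_cases d f : (2 < d)%N -> has_sum d (toC \o f) 2 ->
  has_sum d f 2 \/ exists c P, conj_sum d f c P.
Proof.
move=> d2 [[|[a P] [|[b Q] [|//]]] // _ e].
have one : has_sum d (toC \o f) 1 -> has_sum d f 2.
  by move=> /(has_sum1_real (ltnW (ltnW d2))); apply: has_sum_leq.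
have drop a' P' Q' : lin_sum d (toC \o f) [:: (a', P'); (0, Q')] -> has_sum d f 2.
  move=> e'; apply: one; exists [:: (a', P')] => // k le_kd.
  by rewrite e' // !big_cons !big_nil /= mul0r !addr0.
have [a0|a0] := eqVneq a 0.
  by left; apply: (drop b Q P); rewrite -a0; apply: has_sum_swap.
have [b0|b0] := eqVneq b 0; first by left; apply: (drop a P Q); rewrite -b0.
have [wP|wP] := eqVneq (wedge P (cpt P)) 0; last first.
  by have [/one|] := has_sum1_or_conj_sum d2 a0 wP e; [left|right].
have [wQ|wQ] := eqVneq (wedge Q (cpt Q)) 0; last first.
  by have [/one|] := has_sum1_or_conj_sum d2 b0 wQ (has_sum_swap e); [left|right].
left; apply: (real_has_sum e) => t.
by rewrite !inE => /orP[]/eqP ->.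
Qed.

End RealAndComplexSums.

(** * Ranks as minimal lengths of decompositions *)

Section Ranks.
Variable K : numFieldType.
Implicit Types (F : {mpoly K[2]}) (d m : nat).

Lemma power_sum_has_sum d F m : F \is d.-homog ->
  power_sum d F m <-> has_sum d (bcoef d F) m.
Proof.
move=> hF; split=> [/(power_sumP _ hF)[a [p [q e]]]|[s sz e]].
  exists [seq (a i, (p i, q i)) | i <- enum 'I_m]; first by rewrite size_map size_enum_ord.
  by move=> k le_kd; rewrite e // big_map big_enum.
pose t i := nth (0, (0, 0)) s i; apply/(power_sumP _ hF).
exists (fun i => (t i).1), (fun i => (t i).2.1), (fun i => (t i).2.2) => k le_kd.
by rewrite e // (big_nth (0, (0, 0))) big_mkord sz.
Qed.

Lemma has_sum_full d (f : nat -> K) : (0 < d)%N -> has_sum d f d.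
Proof.
move=> d0; have [a [p [q e]]] := power_decomposition f d0.
exists [seq (a i, (p i, q i)) | i <- enum 'I_d]; first by rewrite size_map size_enum_ord.
by move=> k le_kd; rewrite e // big_map big_enum.
Qed.

(** A decomposition of length d exists, so a minimal one does too and [xget] never returns its
    default. *)
Lemma form_rank_has_sum d F : (0 < d)%N -> F \is d.-homog ->
  has_sum d (bcoef d F) (form_rank d F) /\
  forall m, has_sum d (bcoef d F) m -> (form_rank d F <= m)%N.
Proof.
move=> d0 hF; rewrite /form_rank; case: xgetP => [r _ [h hmin]|none].
  split=> [|m]; first exact/power_sum_has_sum.
  by move=> /(power_sum_has_sum _ hF); apply: hmin.
pose p m := `[< power_sum d F m >].
have ex_p : exists m, p m.
  by exists d; apply/asboolP/power_sum_has_sum => //; apply: has_sum_full.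
case: (ex_minnP ex_p) => r /asboolP pr rmin; case: (none r).
by split=> // m pm; apply: rmin; apply/asboolP.
Qed.

Lemma bcoef_surj d (f : nat -> K) : (0 < d)%N ->
  exists2 F, F \is d.-homog & forall k, (k <= d)%N -> bcoef d F k = f k.
Proof.
move=> d0; have [a [p [q e]]] := power_decomposition f d0.
exists (\sum_(i < d) a i *: lin (p i) (q i) ^+ d) => [|k le_kd].
  by apply: rpred_sum => i _; apply: rpredZ; apply: linX_homog.
by rewrite e // bcoef_sum; apply: eq_bigr => i _; rewrite bcoefZ bcoef_linX.
Qed.

End Ranks.

(** * The forms of maximal gap *)

Section MaximalGap.
Variable R : realType.
Local Notation C := (R[i]).
Local Notation toC := (real_complex R).
Implicit Types (F G : {mpoly R[2]}) (d : nat).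

Lemma bcoef_complexify d F k : bcoef d (complexify F) k = toC (bcoef d F k).
Proof.
by rewrite /bcoef mcoeff_map_mpoly fmorph_div rmorph_nat.
Qed.

Lemma complexify_homog d F : F \is d.-homog -> complexify F \is d.-homog.
Proof.
move=> hF; apply/dhomogP => m; rewrite mcoeff_msupp mcoeff_map_mpoly => Fm.
by apply: contraNeq Fm => ne; rewrite (dhomog_nemf_coeff hF ne) raddf0.
Qed.

Definition conj_form d F := exists c P, conj_sum d (bcoef d F) c P.

Lemma lin_sum_ext (K : numFieldType) d (f f' : nat -> K) s :
  f =1 f' -> lin_sum d f s -> lin_sum d f' s.
Proof. by move=> e h k le_kd; rewrite -e h. Qed.

Lemma complex_rank_has_sum d F : (0 < d)%N -> F \is d.-homog ->
  has_sum d (toC \o bcoef d F) (form_rank d (complexify F)) /\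
  forall m, has_sum d (toC \o bcoef d F) m -> (form_rank d (complexify F) <= m)%N.
Proof.
move=> d0 hF; have [h hmin] := form_rank_has_sum d0 (complexify_homog hF).
split=> [|m [s sz e]].
  by case: h => s sz e; exists s => //; apply: lin_sum_ext e => k; apply: bcoef_complexify.
apply: hmin; exists s => //; apply: lin_sum_ext e => k.
by rewrite bcoef_complexify.
Qed.

Lemma conj_form_gap d F : (1 < d)%N -> F \is d.-homog -> conj_form d F ->
  rank_gap d F = d%:Z - 2.
Proof.
move=> d1 hF [c [P cs]]; have d0 := ltnW d1; rewrite /rank_gap.
have [hR minR] := form_rank_has_sum d0 hF.
have [hC minC] := complex_rank_has_sum d0 hF.
have -> : form_rank d F = d.
  apply/eqP; rewrite eqn_leq (conj_sum_real_rank cs hR) andbT.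
  by apply/minR/has_sum_full.
congr (_ - _%:Z); apply/eqP; rewrite eqn_leq (conj_sum_complex_rank d1 cs hC) andbT.
exact/minC/(conj_sum_has2 cs).
Qed.

(** Complex rank at most 1 leaves a gap of at most 1, complex rank 2 forces real rank at most 2, and
    complex rank at least 3 leaves at most d - 3. All of these are below d - 2 for d at least 4. *)
Lemma nonconj_form_gap d F : (4 <= d)%N -> F \is d.-homog -> ~ conj_form d F ->
  rank_gap d F < d%:Z - 2.
Proof.
move=> d4 hF nc; have d0 : (0 < d)%N by apply: leq_trans d4.
have [_ minR] := form_rank_has_sum d0 hF.
have [hC _] := complex_rank_has_sum d0 hF.
have le_d := minR _ (has_sum_full _ d0).
rewrite /rank_gap; set rR := form_rank d F in minR le_d *.
set rC := form_rank d _ in hC *.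
have [le1|gt1] := leqP rC 1.
  have := minR _ (has_sum1_real d0 (has_sum_leq le1 hC)); lia.
have [le2|gt2] := leqP rC 2; last by lia.
have [|/minR|] := @has_sum2_cases _ d (bcoef d F) _ (has_sum_leq le2 hC).
- exact: leq_trans d4.
- by lia.
- by [].
Qed.

Lemma conj_sum_nonzero d F : (0 < d)%N -> conj_form d F -> F != 0.
Proof.
move=> d0 [c [P cs]]; apply: contraTneq d0 => F0; rewrite -leqNgt.
apply: (conj_sum_real_rank cs); exists [::] => // k _.
by rewrite big_nil F0 bcoef0.
Qed.

Lemma ex_conj_form d : (0 < d)%N -> exists2 F, F \is d.-homog & conj_form d F.
Proof.
(* The witness is (x + i y)^d + (x - i y)^d. *)
move=> d0; pose P : C * C := (1, 'i).
have [F hF e] := bcoef_surj (fun k => complex.Re (2 * lpow d P k)) d0.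
exists F => //; exists 1, P; split; first exact: oner_neq0.
  rewrite /wedge /= conjCi conjC1 !mul1r mulr1 -opprD oppr_eq0.
  by rewrite -mulr2n mulrn_eq0 /= neq0Ci.
move=> k le_kd; rewrite e // conjC1 !mul1r lpow_cpt.
case: (lpow d P k) => a b.
by apply/eqP; rewrite eq_complex /= addr0 mul0r subr0 subrr eqxx andbT; apply/eqP; ring.
Qed.

Lemma max_gap_ptsE d : (4 <= d)%N ->
  @max_gap_pts R d =
  [set proj_pt (complexify F) | F in [set F | F \is d.-homog /\ conj_form d F]].
Proof.
move=> d4; have d0 : (0 < d)%N by apply: leq_trans d4.
have d1 : (1 < d)%N by apply: leq_trans d4.
rewrite /max_gap_pts; congr (image _ _); apply/seteqP; split=> F /=.
  case=> -[hF F0] Fmax; split=> //; apply: contrapT => /(nonconj_form_gap d4 hF).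
  have [G hG cG] := ex_conj_form d0.
  have := Fmax G (conj hG (conj_sum_nonzero d0 cG)).
  by rewrite (conj_form_gap d1 hG cG) leNgt => /negPf ->.
case=> hF cF; split; first by split=> //; apply: conj_sum_nonzero cF.
move=> G [hG _]; rewrite (conj_form_gap d1 hF cF).
have [cG|/(nonconj_form_gap d4 hG)/ltW //] := pselect (conj_form d G).
by rewrite (conj_form_gap d1 hG cG).
Qed.

End MaximalGap.

(** * Projectivities and the map Gamma *)

Section ProjectiveAction.
Variable K : numFieldType.
Implicit Types (A B P Q : K * K) (g : 'M[K]_2) (z : K).

Lemma proj_pt_scale (V : lmodType K) (v : V) c : c != 0 ->
  proj_pt (c *: v) = proj_pt v.
Proof.
move=> c0; apply/seteqP; split=> _ [a /= a0 <-].
  by exists (a * c); rewrite ?scalerA //= mulf_neq0.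
by exists (a / c); rewrite /= ?mulf_neq0 ?invr_eq0 // scalerA divfK.
Qed.

Lemma proj_pt_eq (V : lmodType K) (v w : V) : proj_pt v = proj_pt w ->
  exists2 c, c != 0 & w = c *: v.
Proof.
move=> e; have : proj_pt w w by exists 1; rewrite /= ?oner_neq0 ?scale1r.
by rewrite -e => -[c c0 <-]; exists c.
Qed.

Definition lpt P : {mpoly K[2]} := lin P.1 P.2.

Lemma lptZ c P : lpt (c * P.1, c * P.2) = c *: lpt P.
Proof. by rewrite /lpt linZ. Qed.

Lemma proj_pt_lpt_eq P Q : proj_pt (lpt P) = proj_pt (lpt Q) -> wedge P Q = 0.
Proof.
move=> /proj_pt_eq[c _]; rewrite /lpt linZ => /lin_inj[e1 e2].
by rewrite /wedge e1 e2; ring.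
Qed.

Lemma wedge0_proj_pt P Q : P != (0, 0) -> Q != (0, 0) -> wedge P Q = 0 ->
  proj_pt (lpt P) = proj_pt (lpt Q).
Proof.
move=> P0 Q0 /(wedge0_scale P0)[c eQ]; rewrite eQ lptZ proj_pt_scale //.
by apply: contraNneq Q0 => c0; rewrite eQ c0 !mul0r.
Qed.

Lemma bcoef_lptX d P k : (k <= d)%N -> bcoef d (lpt P ^+ d) k = lpow d P k.
Proof. exact: bcoef_linX. Qed.

Lemma bcoef_lptXB d P Q k : (k <= d)%N ->
  bcoef d (lpt P ^+ d - lpt Q ^+ d) k = lpow d P k - lpow d Q k.
Proof.
move=> le_kd; rewrite bcoefD -scaleN1r bcoefZ mulN1r.
by rewrite !bcoef_lptX.
Qed.

(** The image of x - z y under the substitution that takes x to A and y to B. *)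
Definition pcomb A B z := (A.1 - z * B.1, A.2 - z * B.2).

Lemma wedge_pcomb A B A' B' z : wedge (pcomb A B z) (pcomb A' B' z) =
  wedge A A' + z * - (wedge A B' + wedge B A') + z ^+ 2 * wedge B B'.
Proof. by rewrite /wedge /pcomb /=; ring. Qed.

Lemma wedge_pcomb2 A B z z' :
  wedge (pcomb A B z) (pcomb A B z') = (z - z') * wedge A B.
Proof. by rewrite /wedge /pcomb /=; ring. Qed.

Lemma pcomb_neq0 A B z : wedge A B != 0 -> pcomb A B z != (0, 0).
Proof.
move=> w0; apply: (@wedge_neq0 _ _ (pcomb A B (z - 1))).
by rewrite wedge_pcomb2 opprB addrC subrK mul1r.
Qed.

Lemma quadratic_eq0 (a b c z1 z2 z3 : K) : z1 <> z2 -> z1 <> z3 -> z2 <> z3 ->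
  a + z1 * b + z1 ^+ 2 * c = 0 -> a + z2 * b + z2 ^+ 2 * c = 0 ->
  a + z3 * b + z3 ^+ 2 * c = 0 -> [/\ a = 0, b = 0 & c = 0].
Proof.
move=> /eqP n12 /eqP n13 /eqP n23 e1 e2 e3.
have e12 : b + (z1 + z2) * c = 0.
  apply: (@mulfI _ (z1 - z2)); rewrite ?subr_eq0 // mulr0.
  by rewrite -(subrr 0) -{1}e1 -e2; ring.
have e13 : b + (z1 + z3) * c = 0.
  apply: (@mulfI _ (z1 - z3)); rewrite ?subr_eq0 // mulr0.
  by rewrite -(subrr 0) -{1}e1 -e3; ring.
have c0 : c = 0.
  apply: (@mulfI _ (z2 - z3)); rewrite ?subr_eq0 // mulr0.
  by rewrite -(subrr 0) -{1}e12 -e13; ring.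
have b0 : b = 0 by move: e12; rewrite c0 mulr0 addr0.
by move: e1; rewrite b0 c0 !mulr0 !addr0.
Qed.

Definition col0 g : K * K := (g ord0 ord0, g ord_max ord0).
Definition col1 g : K * K := (g ord0 ord_max, g ord_max ord_max).

Lemma ord2_lift (i : 'I_1) : lift (ord0 : 'I_2) i = ord_max.
Proof. by apply/val_inj; case: i => [[|]]. Qed.

Lemma unitmx_wedge g : (g \in unitmx) = (wedge (col0 g) (col1 g) != 0).
Proof.
rewrite unitmxE unitfE /wedge /=; congr (_ != 0).
rewrite (expand_det_row _ ord0) big_ord_recl big_ord1 /cofactor !det_mx11 !mxE.
have -> : lift (lift ord0 ord0) 0 = ord0 :> 'I_2 by apply/val_inj.
by rewrite !ord2_lift /= addn0 expr0 expr1; ring.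
Qed.

Lemma gl_act_var g (i : 'I_2) : gl_act g 'X_i = lin (g ord0 i) (g ord_max i).
Proof.
rewrite /gl_act comp_mpolyXU -tnth_nth tnth_mktuple.
by rewrite big_ord_recl big_ord1 ord2_lift.
Qed.

Lemma gl_act_root g z :
  gl_act g (xvar K - z *: yvar K) = lpt (pcomb (col0 g) (col1 g) z).
Proof.
rewrite /gl_act comp_mpolyB comp_mpolyZ -!/(gl_act g _) !gl_act_var.
by rewrite -scaleNr linZ linD /lpt /= !mulNr.
Qed.

Lemma gl_act_fermat g d : gl_act g (xvar K ^+ d - yvar K ^+ d) =
  lpt (col0 g) ^+ d - lpt (col1 g) ^+ d.
Proof.
by rewrite /gl_act comp_mpolyB !rmorphXn /= -!/(gl_act g _) !gl_act_var.
Qed.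

Lemma lptX_scale c P d : lpt (c * P.1, c * P.2) ^+ d = c ^+ d *: lpt P ^+ d.
Proof. by rewrite lptZ exprZn. Qed.

Lemma col_scale c g : col0 (c *: g) = (c * (col0 g).1, c * (col0 g).2) /\
  col1 (c *: g) = (c * (col1 g).1, c * (col1 g).2).
Proof. by rewrite /col0 /col1 !mxE. Qed.

Lemma pgl_act_pt g F d : (forall c, gl_act (c *: g) F = c ^+ d *: gl_act g F) ->
  pgl_act (proj_pt g) (proj_pt F) = proj_pt (gl_act g F).
Proof.
move=> hom; have actZ c c' : gl_act (c *: g) (c' *: F) = (c' * c ^+ d) *: gl_act g F.
  by rewrite {1}/gl_act comp_mpolyZ -/(gl_act _ F) hom scalerA.
apply/seteqP; split=> [_ [_ [c /= c0 <-] [_ [c' /= c'0 <-] <-]]|_ [c /= c0 <-]].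
  by exists (c' * c ^+ d); [rewrite /= mulf_neq0 ?expf_neq0 | rewrite actZ].
exists (1 *: g); first by exists 1; rewrite /= ?oner_neq0.
by exists (c *: F); [exists c | rewrite actZ expr1n mulr1].
Qed.

Lemma pgl_act_root g z : pgl_act (proj_pt g) (root_pt z) =
  proj_pt (lpt (pcomb (col0 g) (col1 g) z)).
Proof.
rewrite /root_pt (@pgl_act_pt _ _ 1) ?gl_act_root // => c.
have [e0 e1] := col_scale c g.
by rewrite !gl_act_root expr1 -lptZ e0 e1 /pcomb /=; congr lpt; congr (_, _); ring.
Qed.

Lemma pgl_act_fermat g d :
  pgl_act (proj_pt g) (proj_pt (xvar K ^+ d - yvar K ^+ d)) =
  proj_pt (lpt (col0 g) ^+ d - lpt (col1 g) ^+ d).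
Proof.
rewrite (@pgl_act_pt _ _ d) ?gl_act_fermat // => c.
have [e0 e1] := col_scale c g.
by rewrite !gl_act_fermat e0 e1 !lptX_scale scalerBr.
Qed.

(** The matrix with columns A and B shows that a projectivity exists. For the one chosen by [xget],
    with columns A' and B', the determinant of A - z B and A' - z B' is quadratic in z with three
    roots; hence A' and B' are multiples of A and B. *)
Lemma GammaE d A B (xi : K * K * K) : wedge A B != 0 ->
  xi.1.1 <> xi.1.2 -> xi.1.1 <> xi.2 -> xi.1.2 <> xi.2 ->
  Gamma d (proj_pt (lpt (pcomb A B xi.1.1)), proj_pt (lpt (pcomb A B xi.1.2)),
    proj_pt (lpt (pcomb A B xi.2))) xi = proj_pt (lpt A ^+ d - lpt B ^+ d).
Proof.
move=> w0 n12 n13 n23; rewrite /Gamma /interp_pgl.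
case: xgetP => [_ _ [[g gu <-]]|none]; last first.
  pose g : 'M[K]_2 := \matrix_(i, j)
    let P := if j == ord0 then A else B in if i == ord0 then P.1 else P.2.
  have g0 : col0 g = A by rewrite /col0 !mxE -surjective_pairing.
  have g1 : col1 g = B by rewrite /col1 !mxE -surjective_pairing.
  case: (none (proj_pt g)); split; first by exists g; rewrite //= unitmx_wedge g0 g1.
  by rewrite !pgl_act_root g0 g1.
rewrite !pgl_act_root pgl_act_fermat /=; move: gu; rewrite /= unitmx_wedge.
set A' := col0 g; set B' := col1 g => w0' [].
move=> /proj_pt_lpt_eq q1 /proj_pt_lpt_eq q2 /proj_pt_lpt_eq q3.
rewrite !wedge_pcomb in q1 q2 q3.
have [wA /eqP wAB wB] := quadratic_eq0 n12 n13 n23 q1 q2 q3.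
have wA' : wedge A A' = 0 by rewrite wedge_sym wA oppr0.
have wB' : wedge B B' = 0 by rewrite wedge_sym wB oppr0.
have A0 := wedge_neq0 w0.
have B0 : B != (0, 0) by apply: contraNneq w0 => ->; rewrite /wedge !mulr0 subrr.
have [a eA] := wedge0_scale A0 wA'.
have [b eB] := wedge0_scale B0 wB'.
(* The middle coefficient of the quadratic makes the two factors equal, so that A^d - B^d changes
   only by a scalar. *)
have eab : a = b.
  apply: (mulIf w0); apply/eqP; rewrite -subr_eq0.
  move: wAB; rewrite oppr_eq0 eA eB /wedge /= => /eqP e.
  by apply/eqP; rewrite -[RHS]e; ring.
have a0 : a != 0.
  by apply: contraNneq w0' => a0; rewrite eA a0 !mul0r /wedge !mul0r subr0.
by rewrite eA eB -eab !lptX_scale -scalerBr proj_pt_scale // expf_neq0.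
Qed.

Lemma pcomb_interpolation (P1 P2 P3 : K * K) (z1 z2 z3 : K) :
  wedge P1 P2 != 0 -> wedge P1 P3 != 0 -> wedge P2 P3 != 0 ->
  z1 != z2 -> z1 != z3 -> z2 != z3 ->
  exists A B, [/\ wedge A B != 0, proj_pt (lpt (pcomb A B z1)) = proj_pt (lpt P1),
    proj_pt (lpt (pcomb A B z2)) = proj_pt (lpt P2) &
    proj_pt (lpt (pcomb A B z3)) = proj_pt (lpt P3)].
Proof.
move=> w12 w13 w23 n12 n13 n23.
have d12 : z2 - z1 != 0 by rewrite subr_eq0 eq_sym.
(* A and B solve A - z1 B = s1 P1 and A - z2 B = s2 P2. The scalars are chosen so that, by the
   identity det(P2,P3) P1 - det(P1,P3) P2 + det(P1,P2) P3 = 0, the point A - z3 B is a multiple of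
   P3. *)
pose s1 := (z1 - z3) * wedge P2 P3; pose s2 := (z2 - z3) * wedge P1 P3.
have s10 : s1 != 0 by apply: mulf_neq0; rewrite // subr_eq0.
have s20 : s2 != 0 by apply: mulf_neq0; rewrite // subr_eq0.
pose B := ((s1 * P1.1 - s2 * P2.1) / (z2 - z1), (s1 * P1.2 - s2 * P2.2) / (z2 - z1)).
pose A := (s1 * P1.1 + z1 * B.1, s1 * P1.2 + z1 * B.2).
have w0 : wedge A B != 0.
  have -> : wedge A B = - (s1 * s2 * wedge P1 P2 / (z2 - z1)).
    by rewrite /wedge /A /B /=; field.
  rewrite oppr_eq0.
  exact: mulf_neq0 (mulf_neq0 (mulf_neq0 s10 s20) w12) (invr_neq0 d12).
have P10 := wedge_neq0 w12; have P20 := wedge_neq0 w23.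
have P30 : P3 != (0, 0) by apply: contraNneq w13 => ->; rewrite /wedge !mulr0 subrr.
exists A, B; split=> //; apply: wedge0_proj_pt => //; try exact: pcomb_neq0.
- by rewrite /wedge /pcomb /A /=; ring.
- by rewrite /wedge /pcomb /A /B /=; field.
- by rewrite /pcomb /A /B /s1 /s2 /wedge /=; field.
Qed.

End ProjectiveAction.

(** * Real triples and conjugate pairs of powers *)

Section GammaOfRealTriples.
Variable R : realType.
Local Notation C := (R[i]).
Local Notation toC := (real_complex R).
Implicit Types (A B P : C * C) (z nu : C) (d : nat).

Lemma unit_conj z n : (0 < n)%N -> `|z| ^+ n = 1 -> z * z^* = 1.
Proof.
move=> n0 /eqP; rewrite pexpr_eq1 // => /eqP z1.
by rewrite -normCK z1 expr1n.
Qed.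

Lemma unity_root_conj z n : (0 < n)%N -> z ^+ n = 1 -> z * z^* = 1.
Proof. by move=> n0 zn; apply: (unit_conj n0); rewrite -normrX zn normr1. Qed.

Lemma ex_unity_root_triple d : (3 <= d)%N ->
  exists xi, distinct_triples (@unity_roots C d) xi.
Proof.
move=> d3; pose p : {poly C} := 'X^d - 1.
have [r] := closed_field_poly_normal p.
have /monicP -> : p \is monic by rewrite monicXnsubC // (leq_trans _ d3).
rewrite scale1r => pE.
have ur : uniq r.
  rewrite -separable_prod_XsubC -pE cyclotomic.separable_Xn_sub_1 //.
  by rewrite pnatr_eq0 -lt0n (leq_trans _ d3).
have sr : size r = d.
  have /(congr1 (size \o polyseq)) /= := pE.
  by rewrite size_prod_XsubC size_XnsubC ?(leq_trans _ d3) // => -[].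
have rP z : z \in r -> z ^+ d = 1.
  move=> zr; apply/eqP; have : root p z by rewrite pE root_prod_XsubC.
  by rewrite /root !hornerE subr_eq0.
move: d3 sr ur rP; case: r {pE} => [|z1 [|z2 [|z3 r]]] /=; try by move=> h e; rewrite -e in h.
move=> _ _; rewrite !inE !negb_or => /andP[/and3P[n12 n13 _] /andP[/andP[n23 _] _]] rP.
exists (z1, z2, z3); split; split=> /=; try exact/eqP.
all: by apply: rP; rewrite !inE eqxx ?orbT.
Qed.

Lemma cpt_scale nu P :
  cpt (nu * P.1, nu * P.2) = (nu^* * (cpt P).1, nu^* * (cpt P).2).
Proof. by rewrite /cpt /= !rmorphM. Qed.

(** On the unit circle the conjugate of z is 1/z. Multiplying by z thus turns the condition that A -
    z B is real up to a scalar into a polynomial equation in z. *)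
Lemma wedge_pcomb_conj A B z : z * z^* = 1 ->
  z * wedge (pcomb A B z) (cpt (pcomb A B z)) =
  - wedge (pcomb A B z) (pcomb (cpt B) (cpt A) z).
Proof.
move=> zz; rewrite /wedge /pcomb /cpt /= !rmorphB !rmorphM.
have e x y : z * (x^* - z^* * y^*) = - (y^* - z * x^*).
  by rewrite mulrBr mulrA zz mul1r opprB.
by rewrite mulrBr mulrCA e [z * (_ * _)]mulrCA e; ring.
Qed.

Lemma real_triple_conj A B (z1 z2 z3 : C) : wedge A B != 0 ->
  z1 <> z2 -> z1 <> z3 -> z2 <> z3 ->
  (forall z, z \in [:: z1; z2; z3] -> z * z^* = 1 /\
     wedge (pcomb A B z) (cpt (pcomb A B z)) = 0) ->
  exists nu, [/\ B = (nu * (cpt A).1, nu * (cpt A).2), nu * nu^* = 1 &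
    wedge A (cpt A) != 0].
Proof.
move=> w0 n12 n13 n23 hz.
have q z : z \in [:: z1; z2; z3] -> wedge A (cpt B) +
    z * - (wedge A (cpt A) + wedge B (cpt B)) + z ^+ 2 * wedge B (cpt A) = 0.
  move=> /hz[zz wz]; rewrite -wedge_pcomb; apply/eqP; rewrite -oppr_eq0.
  by rewrite -wedge_pcomb_conj // wz mulr0.
have m1 : z1 \in [:: z1; z2; z3] by rewrite inE eqxx.
have m2 : z2 \in [:: z1; z2; z3] by rewrite !inE eqxx orbT.
have m3 : z3 \in [:: z1; z2; z3] by rewrite !inE eqxx !orbT.
have [_ /eqP wAB wBA] := quadratic_eq0 n12 n13 n23 (q _ m1) (q _ m2) (q _ m3).
have A0 : cpt A != (0, 0).
  apply: contraNneq (wedge_neq0 w0) => e; rewrite -(cptK A) e /cpt /=.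
  by rewrite conjC0.
have [|nu eB] := @wedge0_scale _ (cpt A) B A0; first by rewrite wedge_sym wBA oppr0.
have eAB : wedge A B = nu * wedge A (cpt A) by rewrite eB /wedge /=; ring.
have wA : wedge A (cpt A) != 0 by apply: contraNneq w0 => e; rewrite eAB e mulr0.
exists nu; split=> //; apply: (mulIf wA); apply/eqP; rewrite -subr_eq0 mul1r.
move: wAB; rewrite oppr_eq0 [in wedge B _]eB => /eqP e.
have eBc : cpt B = (nu^* * A.1, nu^* * A.2).
  by rewrite eB cpt_scale cptK.
by rewrite -oppr_eq0 -e -eB eBc [in wedge B _]eB /wedge /=; apply/eqP; ring.
Qed.

Lemma fermat_conj_form d A nu : (0 < d)%N -> nu * nu^* = 1 ->
  wedge A (cpt A) != 0 ->
  exists2 F : {mpoly R[2]}, F \is d.-homog /\ conj_form d F &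
    proj_pt (complexify F) =
    proj_pt (lpt A ^+ d - lpt (nu * (cpt A).1, nu * (cpt A).2) ^+ d).
Proof.
(* Since w^2 = -nu^d and |w| = 1, multiplying the difference by the conjugate of w gives A^d and its
   conjugate power the coefficients conj(w) and w, and the result is a real form. *)
move=> d0 nn wA; pose w := sqrtC (- nu ^+ d).
have w2 : w ^+ 2 = - nu ^+ d by rewrite sqrtCK.
have ww : w * w^* = 1.
  apply: (@unit_conj w 4) => //; rewrite -[4%N]/(2 * 2)%N exprM -normrX w2 normrN.
  by rewrite normrX -exprM mulnC exprM normCK nn expr1n.
have w0 : w != 0.
  by apply/eqP => w0; move: ww; rewrite w0 mul0r => /esym/eqP; rewrite oner_eq0.
have we : - (w^* * nu ^+ d) = w.
  by rewrite -mulrN -w2 expr2 mulrCA [w^* * _]mulrC ww mulr1.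
have [F hF eF] := bcoef_surj
  (fun k => complex.Re (w^* * lpow d A k + w * lpow d (cpt A) k)) d0.
have eFC k : (k <= d)%N -> toC (bcoef d F k) = w^* * lpow d A k + w * lpow d (cpt A) k.
  move=> le_kd; rewrite eF //; set s := _ + _.
  suff /conj_fixed[r ->] : s^* = s by [].
  by rewrite /s rmorphD (rmorphM _ w^*) (rmorphM _ w) /= -!lpow_cpt cptK conjCK addrC.
exists F.
  split=> //; exists w^*, A; split=> //; first by rewrite conjC_eq0.
  by move=> k le_kd; rewrite conjCK eFC.
rewrite -(@proj_pt_scale _ _ (_ - _) w^*) ?conjC_eq0 //; congr proj_pt.
apply: (bcoefP (complexify_homog hF)).
  by apply/rpredZ/rpredB; apply: linX_homog.
move=> k le_kd; rewrite bcoef_complexify eFC // bcoefZ lptX_scale -scaleNr.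
rewrite bcoefD bcoefZ !bcoef_linX // -!/(lpow d _ k) mulrDr; congr (_ + _).
by rewrite mulrA mulrN we.
Qed.

Lemma conj_form_fermat d (F : {mpoly R[2]}) : (0 < d)%N -> F \is d.-homog ->
  conj_form d F -> exists A nu, [/\ nu * nu^* = 1, wedge A (cpt A) != 0 &
    complexify F = lpt A ^+ d - lpt (nu * (cpt A).1, nu * (cpt A).2) ^+ d].
Proof.
move=> d0 hF [c [P [c0 wP e]]].
(* The root g absorbs the coefficient c into the linear form, and nu^d = -1 turns the sum into a
   difference. *)
pose g := d.-root c; pose nu : C := d.-root (-1).
have gd : g ^+ d = c by rewrite rootCK.
have gcd : g^* ^+ d = c^* by rewrite -gd rmorphXn.
have nd : nu ^+ d = -1 by rewrite rootCK.
have g0 : g != 0 by apply: contraNneq c0 => g0; rewrite -gd g0 expr0n eqn0Ngt d0.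
exists (g * P.1, g * P.2), nu; split.
- by apply: (@unit_conj nu d) => //; rewrite -normrX nd normrN1.
- have -> : wedge (g * P.1, g * P.2) (cpt (g * P.1, g * P.2)) = g * g^* * wedge P (cpt P).
    by rewrite /wedge /cpt /= !rmorphM; ring.
  by apply: mulf_neq0 wP; rewrite mulf_neq0 ?conjC_eq0.
apply: (bcoefP (complexify_homog hF)).
  by apply/rpredB; apply: linX_homog.
move=> k le_kd; rewrite bcoef_complexify e // bcoef_lptXB // cpt_scale.
rewrite (lpowZ g P le_kd) (lpowZ nu (g^* * (cpt P).1, g^* * (cpt P).2) le_kd).
rewrite (lpowZ g^* (cpt P) le_kd) gd gcd nd.
by rewrite mulN1r opprK.
Qed.

Lemma complexify_lin (p q : R) : complexify (lin p q) = lin (toC p) (toC q).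
Proof.
by rewrite /complexify /lin raddfD /= !map_mpolyZ !map_mpolyX.
Qed.

(** Together with [real_pts1P] this describes the real points as those fixed by conjugation, the
    form in which the determinants see them. *)
Lemma real_pts1_lpt P : P != (0, 0) -> wedge P (cpt P) = 0 ->
  @real_pts R 1 (proj_pt (lpt P)).
Proof.
move=> P0 /real_pointP[c [r eP]]; exists (lin r.1 r.2).
  split; first exact: lin_homog.
  rewrite lin_neq0; apply: contraNneq P0 => -[r1 r2].
  by rewrite eP r1 r2 !mulr0.
have c0 : c != 0 by apply: contraNneq P0 => c0; rewrite eP c0 !mul0r.
by rewrite complexify_lin eP (lptZ c (toC r.1, toC r.2)) proj_pt_scale.
Qed.

Lemma real_pts1P (L : set {mpoly C[2]}) : @real_pts R 1 L ->
  exists P, [/\ P != (0, 0), wedge P (cpt P) = 0 & L = proj_pt (lpt P)].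
Proof.
case=> F [/= hF F0] <-; move: F0; rewrite (homog1_lin hF) lin_neq0.
move: (bcoef _ _ _) (bcoef _ _ _) => q p pq0; rewrite complexify_lin.
exists (toC p, toC q); split; last exact: erefl.
  by move: pq0; rewrite !xpair_eqE !fmorph_eq0.
by rewrite /wedge /cpt /fst /snd !conj_toC mulrC subrr.
Qed.

End GammaOfRealTriples.

Theorem proposition4p13 (R : realType) (d : nat) (hd : (4 <= d)%N) :
  @max_gap_pts R d =
  \bigcup_(L in distinct_triples (@real_pts R 1))
    (@Gamma (complex R) d L @` distinct_triples (@unity_roots (complex R) d)).
Proof.
have d0 : (0 < d)%N by apply: leq_trans hd.
rewrite (max_gap_ptsE R hd); apply/seteqP; split=> X.
  case=> F [hF cF] <-; have [A [nu [nn wA FE]]] := conj_form_fermat d0 hF cF.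
  set B := (nu * (cpt A).1, nu * (cpt A).2) in FE.
  have nu0 : nu != 0.
    by apply: contra_eq_neq nn => ->; rewrite mul0r eq_sym oner_neq0.
  have wAB : wedge A B != 0.
    have -> : wedge A B = nu * wedge A (cpt A) by rewrite /wedge /B /=; ring.
    exact: mulf_neq0 nu0 wA.
  have [xi [[x1 x2 x3] [n12 n13 n23]]] := @ex_unity_root_triple R d (ltnW hd).
  (* Any triple of roots of unity serves here: for B = nu A* with |nu| = 1 the quadratic vanishes
     identically, so every root of unity yields a real point. *)
  have real_pt z : z ^+ d = 1 -> @real_pts R 1 (proj_pt (lpt (pcomb A B z))).
    move=> zd; have zz := unity_root_conj d0 zd.
    apply: real_pts1_lpt; first exact: pcomb_neq0.
    have z0 : z != 0 by apply: contra_eq_neq zz => ->; rewrite mul0r eq_sym oner_neq0.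
    apply: (mulfI z0); rewrite mulr0 wedge_pcomb_conj // wedge_pcomb.
    rewrite /B cpt_scale cptK.
    transitivity (z * (1 - nu * nu^*) * wedge A (cpt A)).
      by rewrite /wedge /=; ring.
    by rewrite nn subrr mulr0 mul0r.
  have pt_inj z z' : z <> z' ->
      proj_pt (lpt (pcomb A B z)) <> proj_pt (lpt (pcomb A B z')).
    move=> ne /proj_pt_lpt_eq; rewrite wedge_pcomb2 => /eqP.
    rewrite mulf_eq0 (negPf wAB) orbF subr_eq0 => /eqP; exact: ne.
  exists (proj_pt (lpt (pcomb A B xi.1.1)), proj_pt (lpt (pcomb A B xi.1.2)),
          proj_pt (lpt (pcomb A B xi.2))).
    by split; split; [exact: real_pt | exact: real_pt | exact: real_pt |
      exact: pt_inj | exact: pt_inj | exact: pt_inj].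
  by exists xi; [split | rewrite GammaE // FE].
case=> -[[L1 L2] L3] [/= [rL1 rL2 rL3] nL] [xi [[x1 x2 x3] [m12 m13 m23]] <-] /=.
have [P1 [P10 wP1 eP1]] := real_pts1P rL1.
have [P2 [P20 wP2 eP2]] := real_pts1P rL2.
have [P3 [P30 wP3 eP3]] := real_pts1P rL3.
rewrite {}eP1 {}eP2 {}eP3 in nL *; case: nL => n12 n13 n23.
have w0 (P Q : R[i] * R[i]) : P != (0, 0) -> Q != (0, 0) ->
    proj_pt (lpt P) <> proj_pt (lpt Q) -> wedge P Q != 0.
  by move=> ? ? ne; apply/eqP => ?; apply: ne; apply: wedge0_proj_pt.
have [A [B [wAB e1 e2 e3]]] := pcomb_interpolation (w0 _ _ P10 P20 n12)
  (w0 _ _ P10 P30 n13) (w0 _ _ P20 P30 n23)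
  (introN eqP m12) (introN eqP m13) (introN eqP m23).
have := GammaE d wAB m12 m13 m23; rewrite e1 e2 e3 => ->.
(* Being proportional to a real point, A - z B is proportional to its own conjugate, as
   [real_triple_conj] requires. *)
have real_comb z P : P != (0, 0) -> wedge P (cpt P) = 0 ->
    proj_pt (lpt (pcomb A B z)) = proj_pt (lpt P) ->
    wedge (pcomb A B z) (cpt (pcomb A B z)) = 0.
  move=> P0 wP /proj_pt_lpt_eq w; apply: (wedge_trans P0 w).
  have cP0 : cpt P != (0, 0).
    by apply: contraNneq P0 => e; rewrite -(cptK P) e /cpt conjC0.
  by apply: (wedge_trans cP0 _ wP); rewrite wedge_cpt w conjC0.
have [z|nu [eB nn wA]] := real_triple_conj wAB m12 m13 m23.
  rewrite !inE => /or3P[]/eqP->; split.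
  - exact: unity_root_conj x1.
  - exact: real_comb e1.
  - exact: unity_root_conj x2.
  - exact: real_comb e2.
  - exact: unity_root_conj x3.
  - exact: real_comb e3.
have [F [hF cF] FE] := fermat_conj_form d0 nn wA.
by exists F; [split | rewrite [in RHS]eB; exact: FE].
Qed.
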